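(* Let $d\ge2$, and let $\phi:\mathbb R^d\to\mathbb R$ be convex, with $\partial\phi(\mathbb R^d)\subset\mathcal Y$ for some compact convex $\mathcal Y\subset\mathbb R^d$. Let $R>0$, $M>0$, $\theta\in(0,1]$, and let $\tilde\rho\in\mathcal P(\overline B_R)$ satisfy $\tilde\rho(B_\eta(x))\le M\eta^{d-1+\theta}$ for every $x\in\mathbb R^d$ and $\eta>0$. Then, for every $q\in[1,\infty)$ and every $\eta\ge0$, $$\int_{\overline B_R}D_\eta\phi(x)^q\,d\tilde\rho(x)\le c_dMR^{d-1+\theta}D_{\mathcal Y}^q\left(\frac\eta R\right)^\theta,$$ where $c_d=\frac43\,\frac{6^dd^2(d+1)\beta_d}{\beta_{d-1}}$.
   Context: $\mathcal P(E)$ is the set of Borel probability measures on $E$. $B_\eta(x)$ and $\overline B_\eta(x)$ are the open and closed Euclidean balls, $\overline B_R=\overline B_R(0)$. $\beta_k$ is the volume of the unit ball of $\mathbb R^k$, and $D_{\mathcal Y}=\operatorname{diam}(\mathcal Y)$. $\partial\phi$ is the convex subdifferential; for a set $E$, $\partial\phi(E)=\bigcup_{z\in E}\partial\phi(z)$. For $\eta\ge0$, $D_\eta\phi(x):=\operatorname{diam}\partial\phi(\overline B_\eta(x))$, where $\overline B_0(x)=\{x\}$. *)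

(* Defs.v *)
From HB Require Import structures.
From mathcomp Require Import all_boot all_order all_algebra.
From mathcomp Require Import all_classical all_reals all_analysis.

Set Implicit Arguments.
Unset Strict Implicit.
Unset Printing Implicit Defensive.

Import Order.TTheory GRing.Theory Num.Theory.
Import numFieldNormedType.Exports.

Local Open Scope classical_set_scope.
Local Open Scope ring_scope.

Section Euclidean.
Context {R : realType} {d : nat}.
Implicit Types (x y : 'rV[R]_d) (A : set 'rV[R]_d).

Definition dotp x y : R := \sum_i x 0 i * y 0 i.

(* The library's norm on ['rV[R]_d] is the sup norm; it induces the same
   topology but not the same balls. *)
Definition enorm x : R := Num.sqrt (dotp x x).

Definition eball x (eta : R) : set 'rV[R]_d := [set y | enorm (y - x) < eta].

Definition closed_eball x (eta : R) : set 'rV[R]_d :=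
  [set y | enorm (y - x) <= eta].

Definition ediam A : \bar R :=
  ereal_sup [set (enorm (xy.1 - xy.2))%:E | xy in A `*` A].

Definition subdiff (phi : 'rV[R]_d -> R) x : set 'rV[R]_d :=
  [set p | forall y, phi x + dotp p (y - x) <= phi y].

Definition subdiff_set (phi : 'rV[R]_d -> R) A : set 'rV[R]_d :=
  \bigcup_(z in A) subdiff phi z.

Definition Ddiam (phi : 'rV[R]_d -> R) (eta : R) x : \bar R :=
  ediam (subdiff_set phi (closed_eball x eta)).

End Euclidean.

Definition borel_rV (R : realType) (d : nat) :=
  g_sigma_algebraType (@open 'rV[R]_d).

(* [m1 \x m2] under a new head symbol: the library's instance of sigma-finite
   measure for [\x] is shadowed by its instance for subprobabilities, hence is
   not found for Lebesgue measure. *)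
Section SigmaFiniteProduct.
Local Open Scope ereal_scope.
Context d1 d2 (T1 : measurableType d1) (T2 : measurableType d2) (R : realType).
Variable m1 : {sigma_finite_measure set T1 -> \bar R}.
Variable m2 : {sigma_finite_measure set T2 -> \bar R}.

Definition sf_prod : set (T1 * T2) -> \bar R := m1 \x m2.

HB.instance Definition _ := Measure.on sf_prod.

Let sf_prod_sigma_finite : sigma_finite setT sf_prod.
Proof.
have /sigma_finiteP[F [TF ndF Foo]] := sigma_finiteT m1.
have /sigma_finiteP[G [TG ndG Goo]] := sigma_finiteT m2.
exists (fun n => F n `*` G n).
  rewrite -setXTT TF TG predeqE => -[x y]; split.
    move=> [/= [n _ Fnx] [k _ Gky]]; exists (maxn n k) => //; split.
    - by move: x Fnx; exact/subsetPset/ndF/leq_maxl.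
    - by move: y Gky; exact/subsetPset/ndG/leq_maxr.
  by move=> [n _ []/= ? ?]; split; exists n.
move=> k; have [? ?] := Foo k; have [? ?] := Goo k.
split; first exact: measurableX.
by rewrite /sf_prod product_measure1E// lte_mul_pinfty// ge0_fin_numE.
Qed.

HB.instance Definition _ := Measure_isSigmaFinite.Build _ _ _ sf_prod
  sf_prod_sigma_finite.

End SigmaFiniteProduct.

(* Lebesgue measure on R^k, as the k-fold product of the library's
   one-dimensional Lebesgue measure, carried by R * (R * ... * unit). *)
Record sfspace (R : realType) := SFSpace {
  sf_disp : measure_display ;
  sf_sort : measurableType sf_disp ;
  sf_meas : {sigma_finite_measure set sf_sort -> \bar R} }.

Section ProductLebesgue.
Context {R : realType}.
Local Open Scope ereal_scope.

Definition sf_point : sfspace R := @SFSpace R _ unit (\d_tt).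

Definition sf_consR (S : sfspace R) : sfspace R :=
  SFSpace (sf_prod (@lebesgue_measure R) (sf_meas S)).

Fixpoint prod_lebesgue (k : nat) : sfspace R :=
  if k is k'.+1 then sf_consR (prod_lebesgue k') else sf_point.

Fixpoint rV_of_prod (k : nat) : sf_sort (prod_lebesgue k) -> 'rV[R]_k :=
  match k return sf_sort (prod_lebesgue k) -> 'rV[R]_k with
  | 0 => fun=> 0%R
  | k'.+1 => fun p : g_sigma_algebraType R.-ocitv.-measurable * sf_sort (prod_lebesgue k') =>
      (row_mx (const_mx (p.1 : R)) (rV_of_prod p.2) : 'rV[R]_(1 + k'))
  end.

Definition lebesgue_rV (k : nat) (A : set 'rV[R]_k) : \bar R :=
  sf_meas (prod_lebesgue k) (@rV_of_prod k @^-1` A).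

End ProductLebesgue.

Definition beta (R : realType) (k : nat) : R :=
  fine (lebesgue_rV (closed_eball (0 : 'rV[R]_k) 1)).

Definition c_const (R : realType) (d : nat) : R :=
  4 / 3 * (6 ^+ d * d%:R ^+ 2 * (d%:R + 1) * beta R d / beta R d.-1).

(* Main.v *)
Require Import Defs.
From HB Require Import structures.
From mathcomp Require Import all_boot all_order all_algebra.
From mathcomp Require Import all_classical all_reals all_analysis.
From mathcomp Require Import measurable_realfun.
From mathcomp Require Import ring lra.
Import Order.TTheory GRing.Theory Num.Theory.
Import numFieldNormedType.Exports.

(** Write [D] for the diameter of [Y]. It is a bound for [Ddiam phi eta x], so
  [Ddiam phi eta x `^ q <= D `^ (q - 1) * Ddiam phi eta x] and the problem is
  linear in [Ddiam].

  Convexity turns oscillation of the subgradient into second differences: if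
  [p] is a subgradient at distance at most [e] from [y] and [p0] is one at [y],
  then moving by [s] in the direction of [p - p0] raises [phi] above its tangent
  plane at [y] by at least [s * enorm (p - p0)], while on the cross-polytope of
  radius [L >= sqrt d * (e + s)] that excess is at most the sum of the second
  differences of [phi] at [y] with step [L] along the axes
  ([Ddiam_le_axis_diff2]). With [e = s = 2 * eta] this bounds
  [Ddiam phi eta x], for every [y] within [eta] of [x], by a continuous function
  of [y]. Averaging it over these [y] and exchanging the integrals
  ([integral_le_ball_average]) replaces [rho] by Lebesgue measure, at the price
  of the factor [sup_y rho (closed_eball y eta) / (eta ^+ d * beta R d)].

  For Lebesgue measure the integral telescopes ([integral_axis_diff2_le]). A
  second difference is [G y - G (y - L e_i)], where [G] is an increment of [phi]
  over the length [L], and two values of [G] differ by at most [L * D]. By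
  translation invariance the integral over a ball of radius [S] only sees a
  boundary layer of width [L], whose volume is at most
  [d * L * S ^+ d.-1 * beta R d]. Since [L ^+ 2 = 16 * d * eta ^+ 2], the powers
  of [eta] combine to [eta `^ theta] and [beta R d] cancels, which leaves the
  constant [16 * d ^+ 3] up to factors [6 / 5]. That [c_const R d] is larger
  follows from a lower bound for [beta R d / beta R d.-1], obtained from a
  cylinder inscribed in the ball ([beta_succ_ge], [c_const_ge]).

  This works while [eta <= r / 5], so that balls of radius [r + eta] cost no
  more than a factor [6 / 5] in the radius. For larger [eta] the bound
  [Ddiam <= D] is enough, because [rho] has mass one on a ball of radius [r].
  For [eta = 0] the two sides are compared with those for small positive
  radii. *)

Set Implicit Arguments.
Unset Strict Implicit.
Unset Printing Implicit Defensive.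

Local Open Scope classical_set_scope.
Local Open Scope ring_scope.

(** * Euclidean norm *)

Section EuclideanNorm.
Context {R : realType} {d : nat}.
Implicit Types (x y z v : 'rV[R]_d) (a : R).

Lemma dotpC x y : dotp x y = dotp y x.
Proof. by apply: eq_bigr => i _; rewrite mulrC. Qed.

Lemma dotpDl x y z : dotp (x + y) z = dotp x z + dotp y z.
Proof. by rewrite /dotp -big_split; apply: eq_bigr => i _; rewrite mxE mulrDl. Qed.

Lemma dotpZl a x y : dotp (a *: x) y = a * dotp x y.
Proof. by rewrite /dotp mulr_sumr; apply: eq_bigr => i _; rewrite mxE mulrA. Qed.

Lemma dotpNl x y : dotp (- x) y = - dotp x y.
Proof. by rewrite -scaleN1r dotpZl mulN1r. Qed.

Lemma dotpBl x y z : dotp (x - y) z = dotp x z - dotp y z.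
Proof. by rewrite dotpDl dotpNl. Qed.

Lemma dotpDr x y z : dotp x (y + z) = dotp x y + dotp x z.
Proof. by rewrite !(dotpC x) dotpDl. Qed.

Lemma dotpZr a x y : dotp x (a *: y) = a * dotp x y.
Proof. by rewrite !(dotpC x) dotpZl. Qed.

Lemma dotpNr x y : dotp x (- y) = - dotp x y.
Proof. by rewrite !(dotpC x) dotpNl. Qed.

Lemma dotpBr x y z : dotp x (y - z) = dotp x y - dotp x z.
Proof. by rewrite !(dotpC x) dotpBl. Qed.

Lemma dotp0r x : dotp x 0 = 0.
Proof. by rewrite -(scale0r x) dotpZr mul0r. Qed.

Lemma dotp0l x : dotp 0 x = 0.
Proof. by rewrite dotpC dotp0r. Qed.

Lemma dotp_delta x i : dotp x (delta_mx 0 i) = x 0 i.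
Proof.
rewrite /dotp (bigD1 i)//= mxE !eqxx mulr1 big1 ?addr0// => j ji.
by rewrite mxE (negbTE ji) mulr0.
Qed.

Lemma dotp_ge0 x : 0 <= dotp x x.
Proof. by apply: sumr_ge0 => i _; rewrite -expr2 sqr_ge0. Qed.

Lemma enorm_ge0 x : 0 <= enorm x.
Proof. exact: sqrtr_ge0. Qed.

Lemma sqr_enorm x : enorm x ^+ 2 = dotp x x.
Proof. by rewrite sqr_sqrtr// dotp_ge0. Qed.

Lemma enorm_le x a : 0 <= a -> (enorm x <= a) = (dotp x x <= a ^+ 2).
Proof.
by move=> a0; rewrite -sqr_enorm ler_sqr// nnegrE ?enorm_ge0.
Qed.

Lemma enorm_eq0 x : enorm x = 0 -> x = 0.
Proof.
move=> x0; have := sqr_enorm x; rewrite x0 expr0n/= => /esym/eqP.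
rewrite psumr_eq0 => [/allP h|i _]; last by rewrite -expr2 sqr_ge0.
apply/rowP => i; rewrite mxE; apply/eqP.
by have := h i; rewrite mem_index_enum => /(_ isT)/=; rewrite mulf_eq0 orbb.
Qed.

Lemma enorm0 : enorm (0 : 'rV[R]_d) = 0.
Proof. by rewrite /enorm dotp0r sqrtr0. Qed.

Lemma enormZ a x : enorm (a *: x) = `|a| * enorm x.
Proof.
by rewrite /enorm dotpZl dotpZr mulrA -expr2 sqrtrM ?sqr_ge0// sqrtr_sqr.
Qed.

Lemma enormN x : enorm (- x) = enorm x.
Proof. by rewrite -scaleN1r enormZ normrN1 mul1r. Qed.

Lemma enormBC x y : enorm (x - y) = enorm (y - x).
Proof. by rewrite -opprB enormN. Qed.

(** The Cauchy-Schwarz inequality, from the nonnegativity of the square of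
  [enorm y *: x - enorm x *: y]. *)
Lemma dotp_le_enorm x y : dotp x y <= enorm x * enorm y.
Proof.
have [xy0|xy0] := eqVneq (enorm x * enorm y) 0.
  have /eqP := xy0; rewrite mulf_eq0 => /orP[] /eqP/enorm_eq0 ->.
  - by rewrite dotp0l enorm0 mul0r.
  - by rewrite dotp0r enorm0 mulr0.
have xy_gt0 : 0 < enorm x * enorm y.
  by rewrite lt_neqAle eq_sym xy0 mulr_ge0 ?enorm_ge0.
have := dotp_ge0 (enorm y *: x - enorm x *: y).
rewrite !(dotpBl, dotpBr, dotpZl, dotpZr) -!sqr_enorm (dotpC y x) => h.
by rewrite -subr_ge0 -(pmulr_rge0 _ xy_gt0); nra.
Qed.

Lemma enormD x y : enorm (x + y) <= enorm x + enorm y.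
Proof.
rewrite enorm_le ?addr_ge0 ?enorm_ge0// !(dotpDl, dotpDr) (dotpC y x).
by have := dotp_le_enorm x y; rewrite -!sqr_enorm; nra.
Qed.

Lemma enormB_trans y x z : enorm (x - z) <= enorm (x - y) + enorm (y - z).
Proof. by rewrite -[x - z](subrKA y) enormD. Qed.

Lemma enorm_delta (i : 'I_d) : enorm (delta_mx 0 i : 'rV[R]_d) = 1.
Proof. by rewrite /enorm dotp_delta mxE !eqxx sqrtr1. Qed.

Lemma coord_le_enorm x i : `|x 0 i| <= enorm x.
Proof.
rewrite ler_norml -(dotp_delta x i) lerNl -dotpNl.
have h y : dotp y (delta_mx 0 i) <= enorm y.
  by rewrite (le_trans (dotp_le_enorm _ _))// enorm_delta mulr1.
by rewrite -{1}(enormN x) !h.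
Qed.

(** Cauchy-Schwarz against the vector of signs of [x]. *)
Lemma sum_norm_le_enorm x : \sum_i `|x 0 i| <= Num.sqrt d%:R * enorm x.
Proof.
pose u : 'rV[R]_d := \row_i Num.sg (x 0 i).
have -> : \sum_i `|x 0 i| = dotp u x.
  by apply: eq_bigr => i _; rewrite mxE normrEsg.
apply: (le_trans (dotp_le_enorm _ _)).
apply: ler_wpM2r; rewrite ?enorm_ge0// ler_wsqrtr//.
rewrite -[leRHS]mulr_natl mulr1 -[X in _ <= X%:R]card_ord -sumr_const.
apply: ler_sum => i _; rewrite mxE -expr2 sqr_sg.
by case: (_ != _).
Qed.

Lemma enorm_le_sum x : enorm x <= \sum_i `|x 0 i|.
Proof.
rewrite {1}(row_sum_delta x).
elim/big_rec2: _ => [|i a y _ IH]; first by rewrite enorm0.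
by rewrite (le_trans (enormD _ _))// lerD// enormZ enorm_delta mulr1.
Qed.

(** Half of the equivalence with the supremum norm, the one through which
  topological facts about row vectors reach [enorm]. *)
Lemma enorm_le_normr x : enorm x <= d%:R * `|x|.
Proof.
apply: (le_trans (enorm_le_sum x)).
rewrite -[X in _ <= X%:R * _]card_ord mulr_natl -sumr_const.
by apply: ler_sum => i _; rewrite [leRHS]mx_normrE (le_bigmax _ _ (0, i)).
Qed.

End EuclideanNorm.

(** * Subgradients of convex functions *)

Section ConvexFunctions.
Context {R : realType} {d : nat}.
Implicit Types (phi : 'rV[R]_d -> R) (x y z v p : 'rV[R]_d).

Lemma convex_functionP phi : convex_function setT phi ->
  forall (t : R) x y, 0 <= t -> t <= 1 ->
    phi (t *: x + (1 - t) *: y) <= t * phi x + (1 - t) * phi y.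
Proof.
move=> cphi t x y t0 t1.
pose t01 := Itv01 t0 t1.
exact: (cphi t01 x y (in_setT _) (in_setT _)).
Qed.

(** The Hahn-Banach argument, one coordinate at a time: a subgradient on the
  vectors supported on the first [k] coordinates extends to the next one, since
  by convexity the slopes forced from the left ([S] below) never exceed those
  forced from the right. *)
Lemma exists_subgradient phi : convex_function setT phi ->
  forall x, subdiff phi x !=set0.
Proof.
move=> /convex_functionP cphi x.
suff H k : (k <= d)%N -> exists p, forall v,
    (forall i : 'I_d, (k <= i)%N -> v 0 i = 0) -> phi x + dotp p v <= phi (x + v).
  have [p hp] := H d (leqnn d); exists p => y.
  rewrite -[in leRHS](subrKC x y); apply: hp => i.
  by rewrite leqNgt ltn_ord.
elim: k => [_|k IH kd].
  exists 0 => v v0; have -> : v = 0 by apply/rowP => i; rewrite mxE v0.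
  by rewrite dotp0r !addr0.
have [p hp] := IH (ltnW kd); pose i0 := Ordinal kd.
pose e : 'rV[R]_d := delta_mx 0 i0.
pose V (w : 'rV[R]_d) := forall i : 'I_d, (k <= i)%N -> w 0 i = 0 :> R.
have V0 : V 0 by move=> i _; rewrite mxE.
pose S := [set a | exists2 ws : 'rV[R]_d * R, V ws.1 /\ 0 < ws.2 &
  a = (phi x + dotp p ws.1 - phi (x + ws.1 - ws.2 *: e)) / ws.2].
have SU a w t : S a -> V w -> 0 < t ->
    a <= (phi (x + w + t *: e) - phi x - dotp p w) / t.
  move=> [[w' s]/= [Vw' s0] ->] Vw t0.
  rewrite ler_pdivrMr// mulrAC ler_pdivlMr//.
  have st0 : 0 < s + t by rewrite addr_gt0.
  have := cphi (s / (s + t)) (x + w + t *: e) (x + w' - s *: e).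
  have -> : 1 - s / (s + t) = t / (s + t) by field; rewrite gt_eqF.
  rewrite divr_ge0 ?(ltW s0) ?(ltW st0)// ler_pdivrMr// mul1r lerDl (ltW t0).
  move=> /(_ isT isT).
  have -> : (s / (s + t)) *: (x + w + t *: e) + (t / (s + t)) *: (x + w' - s *: e)
      = x + ((s / (s + t)) *: w + (t / (s + t)) *: w').
    by apply/rowP => i; rewrite !mxE; field; rewrite gt_eqF.
  have Vc : V ((s / (s + t)) *: w + (t / (s + t)) *: w').
    by move=> i ki; rewrite !mxE Vw// Vw'// !mulr0 addr0.
  move=> /(le_trans (hp _ Vc)); rewrite dotpDr !dotpZr.
  rewrite -(ler_pM2r st0) => h.
  have {h} : (phi x) * (s + t) + (s * dotp p w + t * dotp p w')
     <= s * phi (x + w + t *: e) + t * phi (x + w' - s *: e).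
    apply: etrans h; congr (_ <= _); field; by rewrite gt_eqF.
  by move=> h; nra.
have Sne : S !=set0.
  by exists ((phi x + dotp p 0 - phi (x + 0 - 1 *: e)) / 1), (0, 1).
have Sub : has_ubound S.
  exists ((phi (x + 0 + 1 *: e) - phi x - dotp p 0) / 1) => a Sa.
  exact: SU.
(* Any number between the left and the right slopes would do. *)
pose a := sup S.
exists (p + (a - p 0 i0) *: e) => v Vv.
pose t := v 0 i0; pose w := v - t *: e.
have Vw : V w.
  move=> i ki; rewrite !mxE eqxx/=; have [->|ii0] := eqVneq i i0.
    by rewrite mulr1 subrr.
  rewrite mulr0 subr0 Vv// ltn_neqAle ki andbT.
  by apply: contra ii0 => /eqP ki0; apply/eqP/val_inj.
have vE : v = w + t *: e by rewrite subrK.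
have -> : dotp (p + (a - p 0 i0) *: e) v = dotp p w + t * a.
  rewrite dotpDl dotpZl (dotpC e) dotp_delta -/t {1}vE dotpDr dotpZr dotp_delta.
  by ring.
rewrite vE [x + (_ + _)]addrA.
have [t0|t0|t0] := ltgtP t 0.
- have /(ub_le_sup Sub) : S ((phi x + dotp p w - phi (x + w - (- t) *: e)) / (- t)).
    by exists (w, - t); rewrite //= oppr_gt0.
  rewrite -/a ler_pdivrMr ?oppr_gt0// scaleNr opprK.
  by move=> h; lra.
- have : a <= (phi (x + w + t *: e) - phi x - dotp p w) / t.
    by apply: ge_sup => // b Sb; exact: SU.
  by rewrite ler_pdivlMr// => h; lra.
- by rewrite t0 scale0r mul0r !addr0 hp.
Qed.

Definition axis_diff2 phi (L : R) (i : 'I_d) x : R :=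
  phi (x + L *: delta_mx 0 i) + phi (x - L *: delta_mx 0 i) - 2 * phi x.

Lemma axis_diff2_ge0 phi L i x : convex_function setT phi ->
  0 <= axis_diff2 phi L i x.
Proof.
move=> cphi; have [p hp] := exists_subgradient cphi x.
have := hp (x + L *: delta_mx 0 i); have := hp (x - L *: delta_mx 0 i).
rewrite ![x + _ - x]addrC !addKr dotpNr /axis_diff2 => *; lra.
Qed.

Lemma axis_diff2_ge_l phi L i x p : subdiff phi x p ->
  phi (x + L *: delta_mx 0 i) - phi x - L * p 0 i <= axis_diff2 phi L i x.
Proof.
move=> hp; have := hp (x - L *: delta_mx 0 i).
by rewrite [x + _ - x]addrC addKr dotpNr dotpZr dotp_delta /axis_diff2; lra.
Qed.

Lemma axis_diff2_ge_r phi L i x p : subdiff phi x p ->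
  phi (x - L *: delta_mx 0 i) - phi x + L * p 0 i <= axis_diff2 phi L i x.
Proof.
move=> hp; have := hp (x + L *: delta_mx 0 i).
by rewrite [x + _ - x]addrC addKr dotpZr dotp_delta /axis_diff2; lra.
Qed.

(** A point [x + v] of the cross-polytope of radius [L] is a convex combination
  of [x] and the vertices [x +- L e_i], with weight [w i = `|v 0 i| / L] on the
  vertex in the direction of [v 0 i]. Jensen's inequality for this combination is
  read off a subgradient [q] at [x + v], and the excess of [phi] at a vertex over
  the plane of slope [p] is at most the second difference. *)
Lemma convex_cross_polytope phi x v p L : convex_function setT phi ->
  0 < L -> \sum_i `|v 0 i| <= L -> subdiff phi x p ->
  phi (x + v) <= phi x + dotp p v + \sum_i axis_diff2 phi L i x.
Proof.
move=> cphi L0 vL hp.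
have [q hq] := exists_subgradient cphi (x + v).
pose w i := `|v 0 i| / L.
have w0 i : 0 <= w i by rewrite divr_ge0// ltW.
have sw1 : \sum_i w i <= 1 by rewrite -mulr_suml ler_pdivrMr// mul1r.
have w1 i : w i <= 1.
  apply: le_trans sw1; rewrite (bigD1 i)//= lerDl sumr_ge0//.
have main i : w i * (phi (x + v) - dotp q v - phi x) + q 0 i * v 0 i
     <= p 0 i * v 0 i + axis_diff2 phi L i x.
  have wL : w i * L = `|v 0 i| by rewrite /w divfK// gt_eqF.
  have A0 := axis_diff2_ge0 L i x cphi.
  have wA : w i * axis_diff2 phi L i x <= axis_diff2 phi L i x by rewrite ler_piMl.
  have [vi0|vi0] := leP 0 (v 0 i).
  - have := hq (x + L *: delta_mx 0 i).
    have -> : x + L *: delta_mx 0 i - (x + v) = L *: delta_mx 0 i - v.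
      by rewrite opprD addrACA subrr add0r.
    rewrite dotpBr dotpZr dotp_delta => h1.
    have h2 := axis_diff2_ge_l L i hp.
    have h3 : phi (x + v) - dotp q v - phi x + L * q 0 i
       <= axis_diff2 phi L i x + L * p 0 i by lra.
    rewrite ger0_norm// in wL.
    have := ler_wpM2l (w0 i) h3.
    by rewrite [w i * (_ + L * q _ _)]mulrDr [w i * (_ + L * p _ _)]mulrDr !mulrA wL; lra.
  - have := hq (x - L *: delta_mx 0 i).
    have -> : x - L *: delta_mx 0 i - (x + v) = - (L *: delta_mx 0 i) - v.
      by rewrite opprD addrACA subrr add0r.
    rewrite dotpBr dotpNr dotpZr dotp_delta => h1.
    have h2 := axis_diff2_ge_r L i hp.
    have h3 : phi (x + v) - dotp q v - phi x - L * q 0 i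
       <= axis_diff2 phi L i x - L * p 0 i by lra.
    rewrite ltr0_norm// in wL.
    have := ler_wpM2l (w0 i) h3.
    by rewrite [w i * (_ - L * q _ _)]mulrBr [w i * (_ - L * p _ _)]mulrBr !mulrA wL; lra.
have : \sum_i (w i * (phi (x + v) - dotp q v - phi x) + q 0 i * v 0 i) <=
   \sum_i (p 0 i * v 0 i + axis_diff2 phi L i x) by exact: ler_sum.
rewrite !big_split/= -mulr_suml -!/(dotp _ _).
have := hq x; rewrite opprD addNKr dotpNr => h.
have : 0 <= (1 - \sum_i w i) * (phi x - (phi (x + v) - dotp q v)).
  by rewrite mulr_ge0// subr_ge0//; lra.
by move=> *; nra.
Qed.

(** Going from [z] by a length [s] along [p - p0], the function outgrows its
  tangent plane at [x] by at least [enorm (p - p0) * s]; the end point lies in the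
  cross-polytope, where the growth is at most the sum on the right. *)
Lemma subgradient_dist phi x z p p0 e s L : convex_function setT phi ->
  0 <= e -> 0 < s -> Num.sqrt d%:R * (e + s) <= L -> 0 < L ->
  enorm (z - x) <= e -> subdiff phi z p -> subdiff phi x p0 ->
  enorm (p - p0) * s <= \sum_i axis_diff2 phi L i x.
Proof.
move=> cphi e0 s0 eL L0 ze hp hp0.
have [pp0|pp0] := eqVneq (enorm (p - p0)) 0.
  by rewrite pp0 mul0r sumr_ge0// => i _; exact: axis_diff2_ge0.
have n0 : 0 < enorm (p - p0) by rewrite lt_neqAle eq_sym pp0 enorm_ge0.
pose u := (s / enorm (p - p0)) *: (p - p0).
have us : enorm u = s.
  by rewrite enormZ ger0_norm ?divr_ge0 ?enorm_ge0 ?(ltW s0)// divfK.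
have hu : dotp (p - p0) u = enorm (p - p0) * s.
  by rewrite dotpZr -sqr_enorm; field.
pose v := (z - x) + u.
have vL : \sum_i `|v 0 i| <= L.
  apply: le_trans (sum_norm_le_enorm _) (le_trans _ eL).
  by rewrite ler_wpM2l ?sqrtr_ge0// (le_trans (enormD _ _))// lerD// us.
have := convex_cross_polytope cphi L0 vL hp0.
have xvE : x + v = z + u by rewrite /v addrA subrKC.
have := hp (z + u); have := hp0 z.
rewrite xvE [z + u]addrC addrK /v (dotpDr p0 (z - x) u) => h1 h2 h3.
by rewrite -hu dotpBl; lra.
Qed.

End ConvexFunctions.

(** * Diameters of subdifferentials *)

Section SubgradientDiameter.
Context {R : realType} {d : nat}.
Implicit Types (phi : 'rV[R]_d -> R) (x y z v p : 'rV[R]_d).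

Lemma ediam_le (A : set 'rV[R]_d) (c : \bar R) :
  (forall p q, A p -> A q -> ((enorm (p - q))%:E <= c)%E) -> (ediam A <= c)%E.
Proof.
move=> h; apply: ge_ereal_sup => _ [[p q]/= [Ap Aq] <-]; exact: h.
Qed.

Lemma le_ediam (A : set 'rV[R]_d) p q : A p -> A q ->
  ((enorm (p - q))%:E <= ediam A)%E.
Proof. by move=> Ap Aq; apply: ereal_sup_ubound; exists (p, q). Qed.

Lemma ediam_ge0 (A : set 'rV[R]_d) : A !=set0 -> (0 <= ediam A)%E.
Proof.
by move=> [p Ap]; apply: le_trans (le_ediam Ap Ap); rewrite lee_fin enorm_ge0.
Qed.

Lemma ediam_subset (A B : set 'rV[R]_d) : A `<=` B -> (ediam A <= ediam B)%E.
Proof. by move=> AB; apply: ediam_le => p q /AB Bp /AB; exact: le_ediam. Qed.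

Lemma compact_ediam_lty (A : set 'rV[R]_d) : compact A -> (ediam A < +oo)%E.
Proof.
move=> /compact_bounded[M [_ HM]].
have {}HM p : A p -> `|p| <= M + 1 by apply: HM; rewrite ltrDl.
apply: (@le_lt_trans _ _ (d%:R * ((M + 1) + (M + 1)))%:E); last by rewrite ltry.
apply: ediam_le => p q Ap Aq; rewrite lee_fin (le_trans (enorm_le_normr _))//.
rewrite ler_wpM2l// (le_trans (ler_normB _ _))// lerD// HM//.
Qed.

Lemma closed_eball_center x e : 0 <= e -> closed_eball x e x.
Proof. by move=> e0; rewrite /closed_eball/= subrr enorm0. Qed.

Lemma closed_eball_sub x y e e' : enorm (x - y) + e <= e' ->
  closed_eball x e `<=` closed_eball y e'.
Proof.
move=> h z; rewrite /closed_eball/= => zx; apply: le_trans h.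
by rewrite (le_trans (enormB_trans x z y))// addrC lerD2l.
Qed.

Lemma subdiff_setS phi (A B : set 'rV[R]_d) : A `<=` B ->
  subdiff_set phi A `<=` subdiff_set phi B.
Proof. by move=> AB; apply: bigcup_subset. Qed.

Lemma Ddiam_ge0 phi e x : convex_function setT phi -> 0 <= e ->
  (0 <= Ddiam phi e x)%E.
Proof.
move=> cphi e0; apply: ediam_ge0.
have [p hp] := exists_subgradient cphi x.
by exists p, x => //; exact: closed_eball_center.
Qed.

Lemma Ddiam_le_Ddiam phi x y e e' : enorm (x - y) + e <= e' ->
  (Ddiam phi e x <= Ddiam phi e' y)%E.
Proof. by move=> h; apply/ediam_subset/subdiff_setS/closed_eball_sub. Qed.

Lemma Ddiam_le_axis_diff2 phi x e s L : convex_function setT phi ->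
  0 <= e -> 0 < s -> Num.sqrt d%:R * (e + s) <= L -> 0 < L ->
  (Ddiam phi e x <= (2 / s * \sum_i axis_diff2 phi L i x)%:E)%E.
Proof.
move=> cphi e0 s0 eL L0; apply: ediam_le => p q [z ze hp] [z' ze' hq].
have [p0 hp0] := exists_subgradient cphi x.
have h1 := subgradient_dist cphi e0 s0 eL L0 ze hp hp0.
have h2 := subgradient_dist cphi e0 s0 eL L0 ze' hq hp0.
rewrite lee_fin mulrAC ler_pdivlMr//.
have := enormB_trans p0 p q; rewrite (enormBC p0).
by nra.
Qed.

Variables (phi : 'rV[R]_d -> R) (D : R).
Hypothesis cphi : convex_function setT phi.
Hypothesis phiD : forall p q, subdiff_set phi setT p -> subdiff_set phi setT q ->
  enorm (p - q) <= D.

(** One subgradient [p0] and the bound on differences confine all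
  subgradients to a ball, whose radius is a Lipschitz constant. *)
Lemma convex_lipschitz : exists2 C, 0 <= C &
  forall x y, `|phi y - phi x| <= C * enorm (y - x).
Proof.
have [p0 hp0] := exists_subgradient cphi 0.
exists (enorm p0 + D).
  rewrite addr_ge0 ?enorm_ge0// (le_trans (enorm_ge0 (p0 - p0)))//.
  by apply: phiD; exists 0.
have H x y : phi y - phi x <= (enorm p0 + D) * enorm (y - x).
  have [p hp] := exists_subgradient cphi y.
  have := hp x; rewrite -opprB dotpNr => h.
  apply: (@le_trans _ _ (enorm p * enorm (y - x))).
    by apply: le_trans (dotp_le_enorm _ _); lra.
  rewrite ler_wpM2r ?enorm_ge0// -[in leLHS](subrKC p0 p).
  apply: (le_trans (enormD _ _)); rewrite lerD2l.
  by apply: phiD; [exists y|exists 0].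
move=> x y; rewrite ler_norml H andbT lerNl opprB (le_trans (H _ _))//.
by rewrite enormBC.
Qed.

Lemma convex_lipschitz_continuous : continuous phi.
Proof.
have [C C0 hC] := convex_lipschitz.
move=> x; apply/(@cvgrPdist_le _ _ _ _ (nbhs_filter x)) => /= e e0.
near=> y.
apply: (le_trans (hC _ _)).
apply: (@le_trans _ _ ((C * d%:R) * `|x - y|)).
  by rewrite -mulrA ler_wpM2l// enorm_le_normr.
apply: (@le_trans _ _ ((C * d%:R + 1) * `|x - y|)).
  by rewrite ler_wpM2r// lerDl.
rewrite mulrC -ler_pdivlMr; last by rewrite ltr_pwDr// mulr_ge0.
near: y.
apply: filterS (_ : ball x (e / (C * d%:R + 1)) `<=` _) _.
  by move=> z; rewrite -ball_normE => /ltW.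
apply: nbhsx_ballx; by rewrite divr_gt0// ltr_pwDr// mulr_ge0.
Unshelve. all: by end_near. Qed.

(** Increments of [phi] over a segment of length [L] lie between [L] times the
  slopes at its two ends. *)
Lemma axis_increment_le L (i : 'I_d) y y' : 0 <= L ->
  phi (y + L *: delta_mx 0 i) - phi y - (phi (y' + L *: delta_mx 0 i) - phi y')
  <= L * D.
Proof.
move=> L0.
have [p hp] := exists_subgradient cphi (y + L *: delta_mx 0 i).
have [q hq] := exists_subgradient cphi y'.
have := hp y; have := hq (y' + L *: delta_mx 0 i).
rewrite [y' + _ - y']addrC addKr opprD addNKr dotpNr !dotpZr !dotp_delta.
have : p 0 i - q 0 i <= D.
  apply: le_trans (_ : enorm (p - q) <= _); last first.
    by apply: phiD; [exists (y + L *: delta_mx 0 i)|exists y'].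
  by apply: le_trans (coord_le_enorm _ i); rewrite !mxE ler_norm.
by move=> /(ler_wpM2l L0); lra.
Qed.

End SubgradientDiameter.

(** * Borel sets of row vectors *)

Section BorelRowVectors.
Context {R : realType} {k : nat}.
Local Notation rV := (borel_rV R k).

Lemma open_measurable_rV (U : set 'rV[R]_k) : open U -> measurable (U : set rV).
Proof. exact: sub_sigma_algebra. Qed.

Lemma continuous_measurable_rV (f : 'rV[R]_k -> R) : continuous f ->
  measurable_fun setT (f : rV -> R).
Proof.
move=> /continuousP cf.
apply: (measurability _ (RGenOpens.measurableE R)).
move=> _ [_ [a [b ->] <-]]; rewrite setTI; apply: open_measurable_rV.
exact/cf/interval_open.
Qed.

Lemma measurable_coord (i : 'I_k) :
  measurable_fun setT (fun x : rV => (x : 'rV[R]_k) 0 i).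
Proof. by apply: continuous_measurable_rV; exact: coord_continuous. Qed.

(** Rational boxes form a countable basis, so measurability into row vectors
  can be tested on coordinates. *)
Lemma measurable_fun_rV d (T : measurableType d) (f : T -> 'rV[R]_k) :
  (forall i, measurable_fun setT (fun x => f x 0 i)) ->
  measurable_fun setT (f : T -> rV).
Proof.
move=> mf; apply: (@measurability _ _ T rV setT f (@open 'rV[R]_k) erefl).
move=> _ [U oU <-]; rewrite setTI.
pose box (qn : 'rV[rat]_k * nat) : set 'rV[R]_k :=
  [set x | forall i, `|x 0 i - ratr (qn.1 0 i)| < qn.2.+1%:R^-1].
pose F qn := if `[< box qn `<=` U >] then f @^-1` box qn else set0.
have -> : f @^-1` U = \bigcup_(qn in setT) F qn.
  apply/seteqP; split=> [t /= Uft|t [qn _]]; last first.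
    by rewrite /F; case: asboolP => // bU /bU.
  have : nbhs (f t) U by exact: open_nbhs_nbhs.
  move=> /nbhs_ballP[e /= e0 eU].
  have [n hn] : exists n, n.+1%:R^-1 + n.+1%:R^-1 < e.
    have e20 : 0 < e / 2 by rewrite divr_gt0.
    have [n] := ltr_add_invr e20; rewrite add0r => hn.
    exists n; rewrite [e]splitr; exact: ltrD.
  have /choice[q hq] i : exists q : rat, f t 0 i < ratr q < f t 0 i + n.+1%:R^-1.
    have [|q qi] := @rat_in_itvoo R (f t 0 i) (f t 0 i + n.+1%:R^-1).
      by rewrite ltrDl.
    by exists q; rewrite in_itv/= in qi.
  have hd i : `|f t 0 i - ratr (q i)| < n.+1%:R^-1.
    have /andP[h1 h2] := hq i.
    by rewrite distrC ger0_norm ?subr_ge0 ?(ltW h1)// ltrBlDl.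
  exists (\row_i q i, n) => //; rewrite /F; case: asboolP => [_ i|]/=.
    by rewrite mxE.
  case=> y hy; apply: eU; rewrite -ball_normE/=.
  rewrite [ltLHS]mx_normrE; apply: bigmax_lt => // -[i j] _/=; rewrite (ord1 i) !mxE.
  apply: le_lt_trans hn; rewrite -(subrKA (ratr (q j))).
  rewrite (le_trans (ler_normD _ _))// lerD// ltW// distrC.
  by have := hy j; rewrite mxE.
apply: countable_bigcupT_measurable => // qn; rewrite /F.
case: asboolP => // _.
have -> : f @^-1` box qn = \bigcap_(i in setT)
    ((fun x => f x 0 i) @^-1` [set y | `|y - ratr (qn.1 0 i)| < qn.2.+1%:R^-1]).
  by apply/seteqP; split=> [t h i _|t h i]; [exact: h|exact: (h i)].
apply: fin_bigcap_measurable => //.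
move=> i _; rewrite -[X in measurable X]setTI; apply: mf => //.
rewrite (_ : [set _ | _] = ball (ratr (qn.1 0 i) : R) qn.2.+1%:R^-1).
  by apply: open_measurable; exact: ball_open.
by apply/seteqP; split=> y; rewrite -ball_normE/= distrC.
Qed.

End BorelRowVectors.

(** * Lebesgue measure on row vectors *)

Section BorelLebesgue.
Context {R : realType}.

Definition rV_cons k (t : R) (z : 'rV[R]_k) : 'rV[R]_k.+1 :=
  (row_mx (const_mx t) z : 'rV[R]_(1 + k)).

Lemma rV_cons0 k t (z : 'rV[R]_k) : rV_cons t z 0 0 = t.
Proof.
transitivity (row_mx (const_mx t : 'rV_1) z 0 (lshift k 0)).
  by congr (row_mx _ _ _ _); exact/val_inj.
by rewrite row_mxEl mxE.
Qed.

Lemma rV_consS k t (z : 'rV[R]_k) j : rV_cons t z 0 (rshift 1 j) = z 0 j.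
Proof. exact: (row_mxEr (const_mx t : 'rV_1) z). Qed.

Lemma ord_rshiftP k (i : 'I_k.+1) : i = 0 \/ exists j : 'I_k, i = rshift 1 j.
Proof.
case: (@split_ordP 1 k i) => j ->; last by right; exists j.
by left; apply/val_inj; rewrite /= (ord1 j).
Qed.

Lemma rV_of_prodS k p :
  @rV_of_prod R k.+1 p = rV_cons (p.1 : R) (rV_of_prod p.2).
Proof. by []. Qed.

Lemma measurable_rV_of_prod k :
  measurable_fun setT (@rV_of_prod R k : _ -> borel_rV R k).
Proof.
apply: measurable_fun_rV; elim: k => [|k IH] i; first by case: i.
have [->|[j ->]] := ord_rshiftP i.
- apply: eq_measurable_fun (@measurable_fst _ _ _ (sf_sort (prod_lebesgue k))).
  by move=> p _; rewrite rV_of_prodS rV_cons0.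
- apply: eq_measurable_fun (measurableT_comp (IH j) measurable_snd).
  by move=> p _; rewrite rV_of_prodS rV_consS.
Qed.

Lemma measurable_rV_cons k t :
  measurable_fun setT (@rV_cons k t : borel_rV R k -> borel_rV R k.+1).
Proof.
apply: measurable_fun_rV => i; have [->|[j ->]] := ord_rshiftP i.
- by apply: eq_measurable_fun (measurable_cst t) => z _; rewrite rV_cons0.
- by apply: eq_measurable_fun (measurable_coord j) => z _; rewrite rV_consS.
Qed.

Lemma measurable_affine_rV k (a : R) (v : 'rV[R]_k) :
  measurable_fun setT ((fun y => a *: y + v) : borel_rV R k -> borel_rV R k).
Proof.
apply: measurable_fun_rV => i.
under eq_fun do rewrite !mxE.
apply: measurable_funD => //; apply: measurable_funM => //.
exact: measurable_coord.
Qed.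

Lemma measurable_translate_rV k (v : 'rV[R]_k) :
  measurable_fun setT ((fun y => y + v) : borel_rV R k -> borel_rV R k).
Proof.
by apply: eq_measurable_fun (measurable_affine_rV 1 v) => y _; rewrite scale1r.
Qed.

(** [lebesgue_rV] as a set function on the Borel sigma-algebra, on which it
  carries the structure of a measure. *)
Definition borel_lebesgue k : set (borel_rV R k) -> \bar R := @lebesgue_rV R k.

Section measure.
Variable k : nat.
Local Open Scope ereal_scope.

Let mpre (A : set (borel_rV R k)) : measurable A ->
  measurable (@rV_of_prod R k @^-1` A).
Proof.
by move=> mA; rewrite -[X in measurable X]setTI; exact: measurable_rV_of_prod.
Qed.

Let borel_lebesgue0 : @borel_lebesgue k set0 = 0.
Proof. by rewrite /borel_lebesgue /lebesgue_rV preimage_set0 measure0. Qed.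

Let borel_lebesgue_ge0 A : 0 <= @borel_lebesgue k A.
Proof. exact: measure_ge0. Qed.

Let borel_lebesgue_sigma_additive : semi_sigma_additive (@borel_lebesgue k).
Proof.
move=> F mF tF mUF; rewrite /borel_lebesgue /lebesgue_rV preimage_bigcup.
apply: measure_semi_sigma_additive.
- by move=> n; exact: mpre.
- apply/trivIsetP => /= i j _ _ ij; rewrite -preimage_setI.
  by move/trivIsetP : tF => /(_ _ _ _ _ ij) ->//; rewrite preimage_set0.
- by rewrite -preimage_bigcup; exact: mpre.
Qed.

HB.instance Definition _ := isMeasure.Build _ _ _ (@borel_lebesgue k)
  borel_lebesgue0 borel_lebesgue_ge0 borel_lebesgue_sigma_additive.

End measure.

Lemma borel_lebesgueS k (A : set 'rV[R]_k.+1) :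
  @borel_lebesgue k.+1 A =
  (\int[@lebesgue_measure R]_t (@borel_lebesgue k (@rV_cons k t @^-1` A)))%E.
Proof.
apply: eq_integral => t _; rewrite /borel_lebesgue /lebesgue_rV/=.
congr (sf_meas _ _); apply/seteqP; split=> z.
- by rewrite xsectionE.
- by rewrite xsectionE.
Qed.

End BorelLebesgue.

(** * Affine changes of variables *)

Section AffineLebesgue.
Context {R : realType}.
Local Notation leb1 := (@lebesgue_measure R).
Local Notation leb := (@borel_lebesgue R).

Lemma measurable_affine (a b : R) :
  measurable_fun setT ((fun t => a * t + b) : measurableTypeR R -> measurableTypeR R).
Proof. by apply: measurable_funD => //; exact: measurable_funM. Qed.

(** By uniqueness of Lebesgue measure it is enough to look at intervals. *)
Lemma lebesgue_measure_affine (a b : R) (A : set R) : 0 < a -> measurable A ->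
  (a%:E * leb1 ((fun t => a * t + b)%R @^-1` A) = leb1 A)%E.
Proof.
move=> a0 mA.
pose a_ := NngNum (ltW a0).
pose T : measurableTypeR R -> measurableTypeR R := fun t => a * t + b.
rewrite [RHS](@lebesgue_measure_unique _ (mscale a_ (pushforward leb1 T)))//.
  exact: measurable_affine.
move=> mT _ [[x y] _ <-].
have E : T @^-1` `]x, y]%classic = `](x - b) / a, (y - b) / a]%classic.
  apply/seteqP; split=> t /=; rewrite !in_itv/= /T;
  by rewrite ltr_pdivrMr// ler_pdivlMr// ltrBlDr lerBrDr (mulrC t).
transitivity (a%:E * leb1 (T @^-1` `]x, y]%classic))%E; last by [].
rewrite E.
rewrite !lebesgue_measure_itv/= !lte_fin ltr_pM2r ?invr_gt0// ltrD2r.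
case: ifPn => xy; last by rewrite mule0.
by rewrite -!EFinB -EFinM; congr EFin; field; rewrite gt_eqF.
Qed.

Lemma ge0_integral_affine (a b : R) (h : R -> \bar R) : 0 < a ->
  measurable_fun setT h -> (forall t, 0 <= h t)%E ->
  (a%:E * \int[leb1]_t h (a * t + b)%R = \int[leb1]_t h t)%E.
Proof.
move=> a0 mh h0.
pose a_ := NngNum (ltW a0).
pose T : measurableTypeR R -> measurableTypeR R := fun t => a * t + b.
have mT : measurable_fun setT T by exact: measurable_affine.
have := @ge0_integral_pushforward _ _ _ _ R T mT leb1 setT h measurableT mh.
rewrite preimage_setT => <-//.
pose m := [the {measure set (measurableTypeR R) -> \bar R} of pushforward leb1 T].
rewrite -(@ge0_integral_mscale _ _ R (m mT) setT measurableT a_ h mh)//.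
apply: eq_measure_integral => //= A mA _.
exact: lebesgue_measure_affine.
Qed.

(** Translation invariance and scaling at once: slicing along the first
  coordinate reduces the claim to dimension one and dimension [k]. *)
Lemma borel_lebesgue_affine k (a : R) (v : 'rV[R]_k) (A : set (borel_rV R k)) :
  0 < a -> measurable A ->
  ((a ^+ k)%:E * leb ((fun y => a *: y + v)%R @^-1` A) = leb A)%E.
Proof.
move=> a0; elim: k v A => [|k IH] v A mA.
  rewrite expr0 mul1e; congr (leb _); apply/funext => y /=.
  by congr A; apply/rowP; case.
rewrite !borel_lebesgueS.
pose v' : 'rV[R]_k := \row_j v 0 (rshift 1 j).
pose h t := leb (@rV_cons R k t @^-1` A).
have mcons t : measurable (@rV_cons R k t @^-1` A : set (borel_rV R k)).
  by rewrite -[X in measurable X]setTI; exact: measurable_rV_cons.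
have consE t z : a *: rV_cons t z + v = rV_cons (a * t + v 0 0) (a *: z + v').
  apply/rowP => i; have [->|[j ->]] := ord_rshiftP i.
  - by rewrite 2!mxE !rV_cons0.
  - by rewrite 2!mxE !rV_consS !mxE.
have mh : measurable_fun setT h.
  have mA' : measurable (@rV_of_prod R k.+1 @^-1` A).
    by rewrite -[X in measurable X]setTI; exact: measurable_rV_of_prod.
  have -> : h = sf_meas (prod_lebesgue k) \o xsection (@rV_of_prod R k.+1 @^-1` A).
    apply/funext => t; rewrite /h /borel_lebesgue /lebesgue_rV/=.
    by congr (sf_meas _ _); apply/seteqP; split=> z; rewrite xsectionE.
  exact: (measurable_fun_xsection (sf_meas (prod_lebesgue k)) mA').
rewrite -[RHS](ge0_integral_affine (v 0 0) a0 mh); last by move=> t; exact: measure_ge0.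
rewrite exprS EFinM -muleA; congr (_ * _)%E.
rewrite -ge0_integralZl//=.
- apply: eq_integral => t _; rewrite /h -[RHS](IH v')//.
  congr (_ * leb _)%E; apply/funext => z /=.
  by rewrite consE.
- rewrite (_ : (fun _ => _) = (fun t => ((a ^- k)%:E * h (a * t + v 0 0)%R)%E)).
    apply: measurable_funeM; apply: (measurableT_comp mh).
    exact: measurable_affine.
  apply/funext => t; rewrite /h -[in RHS](IH v')// muleA -EFinM mulVf ?mul1e.
    by congr (leb _); apply/funext => z /=; rewrite consE.
  by rewrite expf_neq0// gt_eqF.
- by rewrite lee_fin exprn_ge0// ltW.
Qed.

Lemma borel_lebesgue_translate k (v : 'rV[R]_k) (A : set (borel_rV R k)) :
  measurable A -> leb ((fun y => y + v) @^-1` A) = leb A.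
Proof.
move=> mA; rewrite -[RHS](borel_lebesgue_affine v ltr01 mA) expr1n mul1e.
by congr (leb _); apply/funext => y /=; rewrite scale1r.
Qed.

Lemma ge0_integral_translate k (v : 'rV[R]_k) (D : set (borel_rV R k))
    (f : borel_rV R k -> \bar R) : measurable D -> measurable_fun setT f ->
  (forall y, 0 <= f y)%E ->
  (\int[@borel_lebesgue R k]_(y in (fun y : 'rV[R]_k => (y + v)%R) @^-1` D) f (y + v)%R
   = \int[@borel_lebesgue R k]_(y in D) f y)%E.
Proof.
move=> mD mf f0.
pose T : borel_rV R k -> borel_rV R k := fun y => ((y : 'rV[R]_k) + v).
have mT : measurable_fun setT T by exact: measurable_translate_rV.
have := @ge0_integral_pushforward _ _ _ _ R T mT (@borel_lebesgue R k) D f mD (measurable_funTS mf).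
move=> <-//; apply: eq_measure_integral => A mA _.
exact: borel_lebesgue_translate.
Qed.

End AffineLebesgue.

(** * Volumes of balls *)

Section BallVolume.
Context {R : realType}.
Local Notation leb1 := (@lebesgue_measure R).
Local Notation leb := (@borel_lebesgue R).

Lemma measurable_dist k d (T : measurableType d) (f g : T -> borel_rV R k) :
  measurable_fun setT f -> measurable_fun setT g ->
  measurable_fun setT (fun t => enorm ((f t : 'rV[R]_k) - (g t : 'rV[R]_k))).
Proof.
move=> mf mg.
apply: (measurableT_comp (continuous_measurable_fun (@sqrt_continuous R))).
rewrite /dotp; apply: measurable_sum => i.
have mfg : measurable_fun setT (fun t => ((f t : 'rV[R]_k) - (g t : 'rV[R]_k)) 0 i).
  under eq_fun do rewrite !mxE.
  by apply: measurable_funB; apply: (measurableT_comp (measurable_coord i)).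
exact: measurable_funM.
Qed.

Lemma measurable_dist_le k d (T : measurableType d) (f g : T -> borel_rV R k) (e : R) :
  measurable_fun setT f -> measurable_fun setT g ->
  measurable [set t | enorm ((f t : 'rV[R]_k) - (g t : 'rV[R]_k)) <= e].
Proof.
move=> mf mg; have := measurable_dist mf mg.
move=> /(_ measurableT `]-oo, e]%classic (measurable_itv _)).
by rewrite setTI.
Qed.

Lemma measurable_closed_eball k (x : 'rV[R]_k) e :
  measurable (closed_eball x e : set (borel_rV R k)).
Proof.
exact: (@measurable_dist_le k _ (borel_rV R k) id (cst (x : borel_rV R k))).
Qed.

Lemma measurable_eball k (x : 'rV[R]_k) e :
  measurable (eball x e : set (borel_rV R k)).
Proof.
have := @measurable_dist k _ (borel_rV R k) id (cst (x : borel_rV R k)).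
move=> /(_ (@measurable_id _ _ _) (@measurable_cst _ _ _ _ _ _)).
move=> /(_ measurableT `]-oo, e[%classic (measurable_itv _)).
by rewrite setTI.
Qed.

Lemma borel_lebesgue_ball k (x : 'rV[R]_k) s : 0 < s ->
  leb (closed_eball x s) = ((s ^+ k)%:E * leb (closed_eball (0 : 'rV[R]_k) 1))%E.
Proof.
move=> s0.
rewrite -[X in (_ * X)%E](@borel_lebesgue_affine R k s^-1 (- (s^-1 *: x)))//; last 2 first.
- by rewrite invr_gt0.
- exact: measurable_closed_eball.
rewrite muleA -EFinM exprVn mulfV ?mul1e ?expf_neq0 ?gt_eqF//.
congr (leb _); apply/seteqP; split=> y; rewrite /closed_eball/= subr0;
  rewrite -scalerBr enormZ gtr0_norm ?invr_gt0//;
  by rewrite mulrC ler_pdivrMr// mul1r.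
Qed.

Definition cylinder k (A : set R) (B : set 'rV[R]_k) : set 'rV[R]_k.+1 :=
  [set y | A (y 0 0) /\ B (\row_j y 0 (rshift 1 j))].

Lemma borel_lebesgue_cylinder k (A : set R) (B : set (borel_rV R k)) :
  measurable A -> measurable B ->
  leb (cylinder A B) = (leb1 A * leb B)%E.
Proof.
move=> mA mB.
have mB' : measurable (@rV_of_prod R k @^-1` B).
  by rewrite -[X in measurable X]setTI; exact: measurable_rV_of_prod.
rewrite -[RHS](product_measure1E leb1 (sf_meas (prod_lebesgue k)) mA mB').
rewrite /borel_lebesgue /lebesgue_rV.
congr (product_measure1 _ _ _); apply/funext => p.
rewrite /cylinder /= -/(rV_cons _ _) rV_cons0.
by congr (A _ /\ B _); apply/rowP => j; rewrite mxE rV_consS.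
Qed.

Lemma measurable_cylinder k (A : set R) (B : set (borel_rV R k)) :
  measurable A -> measurable B -> measurable (cylinder A B : set (borel_rV R k.+1)).
Proof.
move=> mA mB.
have m0 : measurable_fun setT (fun y : borel_rV R k.+1 => (y : 'rV[R]_k.+1) 0 0).
  exact: measurable_coord.
have mt : measurable_fun setT
    ((fun y => \row_j y 0 (rshift 1 j)) : borel_rV R k.+1 -> borel_rV R k).
  by apply: measurable_fun_rV => i; under eq_fun do rewrite mxE; exact: measurable_coord.
have := measurableI _ _ (m0 measurableT _ mA) (mt measurableT _ mB).
by rewrite !setTI.
Qed.

Lemma dotp_split0 k (y : 'rV[R]_k.+1) :
  dotp y y = y 0 0 ^+ 2 + dotp (\row_j y 0 (rshift 1 j)) (\row_j y 0 (rshift 1 j)).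
Proof.
rewrite {1}/dotp big_ord_recl -expr2; congr (_ + _); apply: eq_bigr => j _.
by rewrite !mxE; congr (y 0 _ * y 0 _); exact/val_inj.
Qed.

(** The unit ball lies in a cylinder over the unit ball one dimension lower. *)
Lemma unit_ball_volume_lty k : (leb (closed_eball (0 : 'rV[R]_k) 1) < +oo)%E.
Proof.
elim: k => [|k IH].
  by rewrite /borel_lebesgue /lebesgue_rV/= diracE; case: (_ \in _); rewrite ltry.
apply: (@le_lt_trans _ _
    (leb (cylinder `[-1, 1]%classic (closed_eball (0 : 'rV[R]_k) 1)))).
  apply: le_measure; rewrite ?inE.
  - exact: measurable_closed_eball.
  - apply: measurable_cylinder; first exact: measurable_itv.
    exact: measurable_closed_eball.
  move=> y; rewrite /closed_eball/= !subr0 => y1; split.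
    by rewrite /= in_itv/= -ler_norml (le_trans (coord_le_enorm _ _)).
  rewrite /= subr0; move: y1; rewrite !enorm_le// dotp_split0; apply: le_trans.
  by rewrite lerDr sqr_ge0.
rewrite borel_lebesgue_cylinder//; last exact: measurable_closed_eball.
rewrite lebesgue_measure_itv/= lte_fin ifT; last by lra.
by rewrite -EFinB lte_mul_pinfty// lee_fin; lra.
Qed.

Lemma unit_ball_volumeE k : leb (closed_eball (0 : 'rV[R]_k) 1) = (beta R k)%:E.
Proof.
rewrite /beta fineK// ge0_fin_numE; first exact: unit_ball_volume_lty.
exact: measure_ge0.
Qed.

Lemma beta_ge0 k : 0 <= beta R k.
Proof. by rewrite -lee_fin -unit_ball_volumeE measure_ge0. Qed.

(** The unit ball contains the cylinder of height one over the ball of radius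
  [3 / 4], because [(1 / 2) ^+ 2 + (3 / 4) ^+ 2 <= 1]. *)
Lemma beta_succ_ge k : (3 / 4) ^+ k * beta R k <= beta R k.+1.
Proof.
rewrite -lee_fin EFinM -!unit_ball_volumeE -(borel_lebesgue_ball 0); last by lra.
apply: (@le_trans _ _ (leb (cylinder `[-2^-1, 2^-1]%classic
   (closed_eball (0 : 'rV[R]_k) (3 / 4))))).
  rewrite borel_lebesgue_cylinder//; last exact: measurable_closed_eball.
  rewrite lebesgue_measure_itv/= lte_fin ifT; last by lra.
  rewrite -EFinB (_ : 2^-1 - - 2^-1 = 1 :> R) ?mul1e//; lra.
apply: le_measure; rewrite ?inE.
- apply: measurable_cylinder; first exact: measurable_itv.
  exact: measurable_closed_eball.
- exact: measurable_closed_eball.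
move=> y [/= ]; rewrite /closed_eball/= !subr0 in_itv/= => /andP[y1 y2].
rewrite !enorm_le//.
rewrite dotp_split0; nra.
Qed.

Lemma beta_gt0 k : 0 < beta R k.
Proof.
elim: k => [|k IH].
  rewrite -lte_fin -unit_ball_volumeE /borel_lebesgue /lebesgue_rV/= diracE.
  by rewrite mem_set//= /closed_eball/= subr0 enorm0.
by apply: lt_le_trans (beta_succ_ge k); rewrite mulr_gt0// exprn_gt0//; lra.
Qed.

Lemma borel_lebesgue_ballE k (x : 'rV[R]_k) s : 0 < s ->
  leb (closed_eball x s) = (s ^+ k * beta R k)%:E.
Proof. by move=> s0; rewrite borel_lebesgue_ball// unit_ball_volumeE -EFinM. Qed.

Lemma borel_lebesgue_sigma_finite k : sigma_finite setT (@borel_lebesgue R k).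
Proof.
exists (fun n => closed_eball (0 : 'rV[R]_k) n.+1%:R).
  apply/esym; rewrite -subTset => y _.
  exists (Num.trunc (enorm y)) => //.
  by rewrite /closed_eball/= subr0 ltW// truncnS_gt.
move=> n; split; first exact: measurable_closed_eball.
by rewrite borel_lebesgue_ballE ?ltry.
Qed.

HB.instance Definition _ k := Measure_isSigmaFinite.Build _ _ _
  (@borel_lebesgue R k) (@borel_lebesgue_sigma_finite k).

End BallVolume.

(** * Averaging over balls *)

Section MonotoneIntegral.
Local Open Scope ereal_scope.
Context d (T : measurableType d) (R : realType) (mu : {measure set T -> \bar R}).

(** Monotonicity for arbitrary nonnegative functions, measurable or not: the
  integral is a supremum over the simple functions below the integrand. *)
Lemma le_integral_ge0 (D : set T) (f g : T -> \bar R) :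
  (forall x, D x -> 0 <= f x) -> (forall x, D x -> f x <= g x) ->
  \int[mu]_(x in D) f x <= \int[mu]_(x in D) g x.
Proof.
move=> f0 fg; have g0 x : D x -> 0 <= g x.
  by move=> Dx; rewrite (le_trans (f0 x Dx))// fg.
rewrite !ge0_integralE//; apply: le_ereal_sup => _ [h /= hf <-].
exists h => //= x; apply: (le_trans (hf x)).
by rewrite !patchE; case: ifPn => // /set_mem; exact: fg.
Qed.

End MonotoneIntegral.

Section Averaging.
Context {R : realType} {k : nat}.
Local Notation rV := (borel_rV R k).
Local Notation leb := (@borel_lebesgue R k).
Local Open Scope ereal_scope.

(** A function [h] that is dominated at [x] by all the values of [g] on the ball
  of radius [eta] around [x] is dominated by the mean of [g] over that ball;
  Tonelli's theorem then integrates [rho] over balls. The function [h] may be a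
  power of [Ddiam], about whose measurability nothing is known here. *)
Lemma integral_le_ball_average (rho : probability rV R) (r eta c : R)
    (h : 'rV[R]_k -> \bar R) (g : rV -> \bar R) :
  (0 < eta)%R -> (0 <= c)%R ->
  (forall y, rho (closed_eball y eta) <= c%:E) ->
  (forall x, 0 <= h x) -> (forall y, 0 <= g y) -> measurable_fun setT g ->
  (forall x y, (enorm (x - y) <= eta)%R -> h x <= g y) ->
  \int[rho]_(x in closed_eball 0%R r) h x <=
  ((eta ^+ k * beta R k)^-1 * c)%:E *
    \int[leb]_(y in closed_eball 0%R (r + eta)) g y.
Proof.
move=> eta0 c0 rhoc h0 g0 mg hg.
pose V := (eta ^+ k * beta R k)%R.
have V0 : (0 < V)%R by rewrite mulr_gt0 ?beta_gt0 ?exprn_gt0.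
pose B : set rV := closed_eball 0%R (r + eta).
have mB : measurable B by exact: measurable_closed_eball.
pose E : set (rV * rV) :=
  [set p | (enorm ((p.1 : 'rV[R]_k) - (p.2 : 'rV[R]_k)) <= eta)%R].
have mE : measurable E.
  by apply: measurable_dist_le; [exact: measurable_fst|exact: measurable_snd].
(* The kernel of the double integral, cut off to the ball that all [y] close
   to the domain of integration belong to. *)
pose f (p : rV * rV) : \bar R := (g \_ B) p.2 * (\1_E p)%:E.
have gB0 y : 0 <= (g \_ B) y by rewrite erestrict_ge0.
have mgB : measurable_fun setT (g \_ B).
  by apply/(measurable_restrictT _ _).1 => //; exact: measurable_funTS.
have f0 p : 0 <= f p by rewrite mule_ge0// lee_fin.
have mf : measurable_fun setT f.
  apply: emeasurable_funM; first exact: (measurableT_comp mgB).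
  exact/measurable_EFinP/measurable_indic.
pose H x := \int[leb]_y f (x, y).
have H0 x : 0 <= H x by exact: integral_ge0.
have mH : measurable_fun setT H by exact: measurable_fun_fubini_tonelli_F.
have hH x : closed_eball 0%R r x -> h x <= (V^-1)%:E * H x.
  move=> xr; rewrite muleC lee_pdivlMr// /V.
  rewrite -(borel_lebesgue_ballE x)// -integral_cst; last first.
    exact: measurable_closed_eball.
  apply: (@le_trans _ _ (\int[leb]_(y in closed_eball x eta) g y)).
    apply: le_integral_ge0 => //= y xy; apply: hg; by rewrite enormBC.
  rewrite integral_mkcond; apply: le_integral_ge0 => y _.
    by rewrite erestrict_ge0.
  rewrite /f/= !patchE indicE.
  case: ifPn => [/set_mem xy|_]; last by case: ifPn => _; rewrite mule_ge0// lee_fin.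
  rewrite !mem_set ?mule1//=; first by rewrite /E/= enormBC.
  rewrite /B /closed_eball/= (le_trans (enormB_trans x _ _))// addrC lerD//.
apply: (@le_trans _ _ (\int[rho]_(x in closed_eball 0%R r) ((V^-1)%:E * H x))).
  exact: le_integral_ge0.
apply: (@le_trans _ _ (\int[rho]_x ((V^-1)%:E * H x))).
  apply: ge0_subset_integral => //.
  - exact: measurable_closed_eball.
  - exact: measurable_funeM.
  - by move=> x _; rewrite mule_ge0// lee_fin invr_ge0 ltW.
rewrite ge0_integralZl//; last by rewrite lee_fin invr_ge0 ltW.
rewrite EFinM -muleA; apply: lee_wpmul2l; first by rewrite lee_fin invr_ge0 ltW.
rewrite /H (fubini_tonelli f)//.
rewrite -ge0_integralZl ?lee_fin//; last exact: measurable_funTS.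
rewrite [leRHS]integral_mkcond; apply: le_integral_ge0 => y _.
  exact: integral_ge0.
rewrite /f/= ge0_integralZl//; last first.
  have m1E : measurable_fun setT (\1_E : rV * rV -> R) by exact: measurable_indic.
  apply/measurable_EFinP; apply: (measurableT_comp m1E).
  exact: measurable_fun_pair.
rewrite [X in _ * X](_ : _ = rho (closed_eball y eta)); last first.
  rewrite -[X in _ = _ X]setIT -integral_indic//; last exact: measurable_closed_eball.
rewrite !patchE; case: ifPn => _; last by rewrite mul0e.
by rewrite muleC lee_wpmul2r.
Qed.

End Averaging.

(** * Integrals of second differences *)

Section SecondDifference.
Context {R : realType} {d : nat}.
Local Notation rV := (borel_rV R d).
Local Notation leb := (@borel_lebesgue R d).

(** The volume of a spherical shell of width [L], up to the factor [beta]. *)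
Lemma exprB_sub_le (S L : R) : 0 <= L -> L <= S ->
  S ^+ d - (S - L) ^+ d <= d%:R * L * S ^+ d.-1.
Proof.
move=> L0 LS; have S0 : 0 <= S by exact: le_trans LS.
case: d => [|n] /=; first by rewrite !expr0 subrr !mul0r.
elim: n => [|n IH]; first by rewrite expr0 !expr1; lra.
have h : (S - L) ^+ n.+1 <= S ^+ n.+1 by apply: lerXn2r; rewrite ?nnegrE; lra.
have h1 := ler_wpM2l L0 h; have h2 := ler_wpM2l S0 IH.
have e1 : S ^+ n.+2 = S * S ^+ n.+1 by rewrite exprS.
have e2 : (S - L) ^+ n.+2 = (S - L) * (S - L) ^+ n.+1 by rewrite exprS.
have e3 : S ^+ n.+1 = S * S ^+ n by rewrite exprS.
have e4 : n.+2%:R = n.+1%:R + 1 :> R by rewrite -natr1.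
rewrite e1 e2 e4; move: h2; rewrite mulrBr [X in _ <= X]mulrCA.
rewrite -e3 => h2.
apply: (@le_trans _ _ (S * S ^+ n.+1 - S * (S - L) ^+ n.+1 + L * S ^+ n.+1)).
  lra.
lra.
Qed.

Variables (phi : 'rV[R]_d -> R) (D : R).
Hypothesis cphi : convex_function setT phi.
Hypothesis phiD : forall p q, subdiff_set phi setT p -> subdiff_set phi setT q ->
  enorm (p - q) <= D.

Lemma measurable_convex : measurable_fun setT (phi : rV -> R).
Proof. by apply: continuous_measurable_rV; exact: convex_lipschitz_continuous phiD. Qed.

Lemma measurable_axis_diff2 L i :
  measurable_fun setT (axis_diff2 phi L i : rV -> R).
Proof.
rewrite /axis_diff2; apply: measurable_funB; last first.
  by apply: measurable_funM => //; exact: measurable_convex.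
by apply: measurable_funD; apply: (measurableT_comp measurable_convex);
  exact: measurable_translate_rV.
Qed.

Lemma diam_ge0 : 0 <= D.
Proof.
have [p hp] := exists_subgradient cphi 0.
by apply: le_trans (enorm_ge0 (p - p)) (phiD _ _); exists 0.
Qed.

(** The second difference is [G y - G (y - L e_i)], so its integral over the
  ball [B] is the difference of the integrals of [G] over [B] and over the
  translate [B'] of [B]. The part [I] common to both cancels, and what remains
  of [B] is weighted by [G <= L * D]. *)
Lemma integral_axis_diff2_sub (L S : R) i (I : set rV) : 0 <= L -> 0 < S ->
  measurable I -> I `<=` closed_eball 0 S ->
  (forall z, I z -> closed_eball 0 S (z + L *: delta_mx 0 i)) ->
  (\int[leb]_(y in closed_eball 0%R S) (axis_diff2 phi L i y)%:E <=
   (L * D)%:E * leb (closed_eball 0%R S `\` I))%E.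
Proof.
move=> L0 S0 mI IB IB'.
pose e : 'rV[R]_d := delta_mx 0 i.
pose F (y : 'rV[R]_d) := phi (y + L *: e) - phi y.
have FF y y' : F y - F y' <= L * D by exact: axis_increment_le.
have lbF : has_lbound (range F).
  by exists (F 0 - L * D) => _ [y _ <-]; have := FF 0 y; lra.
(* Subtracting the infimum makes the increment nonnegative, so that only
   integrals of nonnegative functions occur. *)
pose m := inf (range F).
pose G (y : 'rV[R]_d) := F y - m.
have G0 y : 0 <= G y by rewrite subr_ge0; apply: ge_inf => //; exists y.
have GLD y : G y <= L * D.
  suff : F y - L * D <= m by rewrite /G; lra.
  apply: lb_le_inf; first by exists (F 0), 0.
  by move=> _ [y' _ <-]; have := FF y y'; lra.
pose B : set rV := closed_eball 0 S.
have mB : measurable B by exact: measurable_closed_eball.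
pose B' : set rV := (fun y => y + L *: e) @^-1` B.
have mB' : measurable B'.
  by rewrite -[X in measurable X]setTI; exact: measurable_translate_rV.
have mG : measurable_fun setT (EFin \o G : rV -> \bar R).
  apply/measurable_EFinP; apply: measurable_funB => //.
  apply: measurable_funB; last exact: measurable_convex.
  by apply: (measurableT_comp measurable_convex); exact: measurable_translate_rV.
have diffE y : axis_diff2 phi L i y = G y - G (y - L *: e).
  by rewrite /G /F subrK /axis_diff2 -/e; lra.
have D0 := diam_ge0; have LD0 : 0 <= L * D by rewrite mulr_ge0.
have GE0 y : (0 <= (G y)%:E)%E by rewrite lee_fin.
have step1 : (\int[leb]_(y in B) (axis_diff2 phi L i y)%:E
   + \int[leb]_(y in B') (G y)%:E = \int[leb]_(y in B) (G y)%:E)%E.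
  have -> : (\int[leb]_(y in B') (G y)%:E
      = \int[leb]_(y in B) (G (y - L *: e))%:E)%E.
    rewrite -(ge0_integral_translate (- (L *: e)) mB' mG)//.
    congr (integral _ _ _); apply/seteqP; split=> y; rewrite /B'/=;
      by rewrite subrK.
  rewrite -ge0_integralD//.
  - by apply: eq_integral => y _; rewrite -EFinD diffE subrK.
  - by move=> y _; rewrite lee_fin axis_diff2_ge0.
  - apply/measurable_funTS/measurable_EFinP; exact: measurable_axis_diff2.
  - apply/measurable_funTS.
    exact: (measurableT_comp mG (measurable_translate_rV (- (L *: e)))).
have step2 : (\int[leb]_(y in B) (G y)%:E <=
    \int[leb]_(y in B') (G y)%:E + (L * D)%:E * leb (B `\` I))%E.
  have BE : B = I `|` (B `\` I) by rewrite setDUK.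
  rewrite [in leLHS]BE ge0_integral_setU//; last 3 first.
  - exact: measurableD.
  - exact: measurable_funTS.
  - by apply/disj_setPS => y [Iy [_ /(_ Iy)]].
  apply: leeD.
    by apply: ge0_subset_integral => //; exact: measurable_funTS.
  rewrite -integral_cst; last exact: measurableD.
  by apply: le_integral_ge0 => y _ //=; rewrite lee_fin.
(* Finiteness is what allows the cancellation of the integral over [B']. *)
have finB' : (\int[leb]_(y in B') (G y)%:E)%E \is a fin_num.
  rewrite ge0_fin_numE ?integral_ge0//.
  apply: (@le_lt_trans _ _ (\int[leb]_(y in B') (L * D)%:E)%E).
    by apply: le_integral_ge0 => y _ //=; rewrite lee_fin.
  rewrite integral_cst// [X in (_ * X)%E](borel_lebesgue_translate (L *: e) mB).
  by rewrite borel_lebesgue_ballE// -EFinM ltry.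
move: step2; rewrite -step1 addeC leeD2lE//.
Qed.

(** The balls of radius [S] around [0] and around its translate share the
  concentric ball of radius [S - L], so only a layer of width [L] remains; if
  [L >= S], the whole ball is such a layer. *)
Lemma integral_axis_diff2_le (L S : R) i : 0 <= L -> 0 < S ->
  (\int[leb]_(y in closed_eball 0%R S) (axis_diff2 phi L i y)%:E <=
   (L * D * (d%:R * L * S ^+ d.-1 * beta R d))%:E)%E.
Proof.
move=> L0 S0; have D0 := diam_ge0.
have LD0 : 0 <= L * D by rewrite mulr_ge0.
have d0 : (0 < d)%N by exact: leq_ltn_trans (ltn_ord i).
have [LS|SL] := ltP L S.
- pose I : set rV := closed_eball 0 (S - L).
  have mI : measurable I by exact: measurable_closed_eball.
  have mS : measurable (closed_eball 0 S : set rV) by exact: measurable_closed_eball.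
  have IS : I `<=` closed_eball 0 S.
    by move=> z; rewrite /I /closed_eball/= => /le_trans; apply; lra.
  apply: (le_trans (@integral_axis_diff2_sub L S i I L0 S0 mI IS _)).
    move=> z; rewrite /I /closed_eball/= !subr0 => h.
    by rewrite (le_trans (enormD _ _))// enormZ enorm_delta ger0_norm//; lra.
  rewrite [leRHS]EFinM lee_wpmul2l ?lee_fin// measureD//; last first.
    by rewrite /= borel_lebesgue_ballE ?ltry.
  rewrite /= (setIidr IS) !borel_lebesgue_ballE ?subr_gt0//.
  rewrite -EFinB lee_fin -mulrBl ler_wpM2r ?beta_ge0//.
  by rewrite exprB_sub_le// ltW.
- apply: (le_trans (@integral_axis_diff2_sub L S i set0 L0 S0 _ _ _)) => //.
  rewrite setD0 borel_lebesgue_ballE// [leRHS]EFinM lee_wpmul2l ?lee_fin//.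
  rewrite ler_wpM2r ?beta_ge0// -[in leLHS](prednK d0) exprS.
  rewrite ler_wpM2r ?exprn_ge0 ?(ltW S0)//.
  by rewrite (le_trans SL)// ler_peMl// ler1n.
Qed.

End SecondDifference.

(** * The estimate *)

Section Constants.
Context {R : realType}.

Lemma powR_predD d (theta x : R) : (0 < d)%N -> 0 < x ->
  x `^ (d%:R - 1 + theta) = x ^+ d.-1 * x `^ theta.
Proof.
move=> d0 x0; rewrite powRD; last by rewrite (gt_eqF x0) implybT.
by rewrite -{1}(prednK d0) -natr1 addrK powR_mulrn// ltW.
Qed.

(** With [n = d - 1] and [beta R d / beta R n >= (3 / 4) ^+ n] the claim reduces
  to [12 / 5 * (36 / 25) ^+ n <= (9 / 2) ^+ n], true as soon as [n >= 1]. *)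
Lemma c_const_ge d : (2 <= d)%N ->
  16 * d%:R ^+ 3 * ((6 / 5) ^+ d * (6 / 5) ^+ d.-1) <= c_const R d.
Proof.
case: d => [//|n] /= n0; rewrite /c_const/=.
have b0 := beta_gt0 (R := R) n.
have hb : (3 / 4) ^+ n <= beta R n.+1 / beta R n.
  by rewrite ler_pdivlMr// beta_succ_ge.
rewrite -[_ * beta R n.+1 / _]mulrA.
set N : R := n.+1%:R; have N1 : 1 <= N by rewrite ler1n.
have N0 : 0 <= N by exact: le_trans N1.
apply: (@le_trans _ _ (4 / 3 * (6 ^+ n.+1 * N ^+ 2 * (N + 1) * (3 / 4) ^+ n))); last first.
  by rewrite ler_wpM2l// ler_wpM2l// !mulr_ge0 ?exprn_ge0//; lra.
rewrite !exprS !expr0 !mulr1.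
have hX : (6 / 5) ^+ n * (6 / 5) ^+ n = (36 / 25) ^+ n :> R.
  by rewrite -exprMn; congr (_ ^+ _); field.
have hY : 6 ^+ n * (3 / 4) ^+ n = (9 / 2) ^+ n :> R.
  by rewrite -exprMn; congr (_ ^+ _); field.
have hXY : 12 / 5 * (36 / 25) ^+ n <= (9 / 2) ^+ n :> R.
  case: n n0 {b0 hb N N1 N0 hX hY} => // n _; rewrite !exprS.
  have : (36 / 25) ^+ n <= (9 / 2) ^+ n :> R by apply: lerXn2r; rewrite ?nnegrE; lra.
  have : 0 <= (36 / 25) ^+ n :> R by apply: exprn_ge0; lra.
  by lra.
have -> : 16 * (N * (N * N)) * (6 / 5 * (6 / 5) ^+ n * (6 / 5) ^+ n)
  = N ^+ 2 * N * (8 * (12 / 5 * (36 / 25) ^+ n)) by rewrite -hX; field.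
have -> : 4 / 3 * (6 * 6 ^+ n * (N * N) * (N + 1) * (3 / 4) ^+ n)
  = N ^+ 2 * (N + 1) * (8 * (9 / 2) ^+ n) by rewrite -hY; field.
apply: ler_pM.
- by rewrite mulr_ge0 ?exprn_ge0//; lra.
- by rewrite !mulr_ge0 ?exprn_ge0//; lra.
- by rewrite ler_wpM2l ?exprn_ge0//; lra.
- by rewrite ler_wpM2l.
Qed.

End Constants.

Section Main.
Context {R : realType} {d : nat}.
Local Notation rV := (borel_rV R d).
Local Notation leb := (@borel_lebesgue R d).
Variables (phi : 'rV[R]_d -> R) (D : R).
Hypothesis cphi : convex_function setT phi.
Hypothesis phiD : forall p q, subdiff_set phi setT p -> subdiff_set phi setT q ->
  enorm (p - q) <= D.
Variables (r M theta q : R) (rho : probability rV R).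
Hypotheses (d2 : (2 <= d)%N) (r0 : 0 < r) (M0 : 0 < M).
Hypotheses (theta0 : 0 < theta) (theta1 : theta <= 1) (q1 : 1 <= q).
Hypothesis rho_supp : rho (closed_eball 0 r) = 1%E.
Hypothesis rho_ball : forall (x : 'rV[R]_d) (eta : R), 0 < eta ->
  (rho (eball x eta) <= (M * eta `^ (d%:R - 1 + theta))%:E)%E.

Let d0 : (0 < d)%N := ltnW d2.
Let D0 : 0 <= D := diam_ge0 cphi phiD.
Let q0 : 0 < q := lt_le_trans ltr01 q1.

Lemma Ddiam_le eta x : (Ddiam phi eta x <= D%:E)%E.
Proof.
apply: ediam_le => p p' [z _ hp] [z' _ hp']; rewrite lee_fin.
by apply: phiD; [exists z|exists z'].
Qed.

(** The hypothesis on open balls is applied at radius [6 / 5 * eta], which is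
  enough to contain the closed ball of radius [eta]. *)
Lemma closed_ball_mass_le (x : 'rV[R]_d) (eta : R) : 0 < eta ->
  (rho (closed_eball x eta) <=
     (M * ((6 / 5) ^+ d * (eta ^+ d.-1 * eta `^ theta)))%:E)%E.
Proof.
move=> eta0; have eta' : 0 < 6 / 5 * eta by rewrite mulr_gt0//; lra.
apply: (@le_trans _ _ (rho (eball x (6 / 5 * eta)))).
  apply: le_measure; rewrite ?inE.
  - exact: measurable_closed_eball.
  - exact: measurable_eball.
  - by move=> y; rewrite /closed_eball /eball/= => h; nra.
apply: (le_trans (rho_ball x eta')); rewrite lee_fin ler_wpM2l ?(ltW M0)//.
rewrite powRM ?(ltW eta0)//.
rewrite (powR_predD _ d0 eta0) ler_wpM2r//.
  by rewrite mulr_ge0 ?powR_ge0// exprn_ge0// ltW.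
rewrite -powR_mulrn; last by lra.
apply: ler_powR; first by lra.
by move: theta1; lra.
Qed.

Lemma Ddiam_pow_le eta x : 0 <= eta ->
  (Ddiam phi eta x `^ q <= (D `^ (q - 1))%:E * Ddiam phi eta x)%E.
Proof.
move=> eta0; have := Ddiam_ge0 x cphi eta0; have := Ddiam_le eta x.
case: (Ddiam phi eta x) => [a| |]//; rewrite !lee_fin => aD a0.
rewrite -(mulr_powRB1 a0 q0) mulrC ler_wpM2r//.
by apply: ge0_ler_powR; rewrite ?nnegrE ?subr_ge0.
Qed.

Lemma Ddiam_pow_le_cst eta x : 0 <= eta -> (Ddiam phi eta x `^ q <= (D `^ q)%:E)%E.
Proof.
move=> eta0; apply: (le_trans (Ddiam_pow_le x eta0)).
rewrite -(mulr_powRB1 D0 q0) mulrC EFinM lee_wpmul2l ?lee_fin ?powR_ge0//.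
exact: Ddiam_le.
Qed.

Lemma Ddiam_pow_le_pow eta eta' x : 0 <= eta -> eta <= eta' ->
  (Ddiam phi eta x `^ q <= Ddiam phi eta' x `^ q)%E.
Proof.
move=> eta0 ee'; have eta'0 : 0 <= eta' by exact: le_trans ee'.
apply: gt0_ler_poweR; rewrite ?(ltW q0)// ?in_itv/= ?leey ?Ddiam_ge0//.
by apply: Ddiam_le_Ddiam; rewrite subrr enorm0 add0r.
Qed.

(** Averaging with [h x = Ddiam phi eta x `^ q] and, for [g], the second
  differences that bound [Ddiam phi (2 * eta) y]. *)
Lemma integral_Ddiam_small_radius eta : 0 < eta -> eta <= r / 5 ->
  (\int[rho]_(x in closed_eball 0%R r) (Ddiam phi eta x `^ q) <=
   (c_const R d * M * r `^ (d%:R - 1 + theta) * D `^ q * (eta / r) `^ theta)%:E)%E.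
Proof.
move=> eta0 etar.
pose L := Num.sqrt d%:R * (2 * eta + 2 * eta).
have L0 : 0 < L by rewrite mulr_gt0 ?sqrtr_gt0 ?ltr0n// addr_gt0// mulr_gt0.
pose K := D `^ (q - 1) * eta^-1.
have K0 : 0 <= K by rewrite mulr_ge0 ?powR_ge0// invr_ge0 ltW.
pose gs (y : rV) := K * \sum_i axis_diff2 phi L i y.
have sum0 y : 0 <= \sum_i axis_diff2 phi L i y.
  by apply: sumr_ge0 => i _; exact: axis_diff2_ge0.
have gs0 y : 0 <= gs y.
  by rewrite mulr_ge0.
have msum : measurable_fun setT (fun y : rV => \sum_i axis_diff2 phi L i y).
  by apply: measurable_sum => i; exact: (measurable_axis_diff2 cphi phiD).
have mgs : measurable_fun setT (EFin \o gs).
  apply/measurable_EFinP; rewrite /gs.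
  exact: measurable_funM.
pose c := M * ((6 / 5) ^+ d * (eta ^+ d.-1 * eta `^ theta)).
have c0 : 0 <= c.
  have e0 := ltW eta0.
  by rewrite mulr_ge0 ?(ltW M0)// mulr_ge0 ?exprn_ge0// mulr_ge0 ?powR_ge0 ?exprn_ge0.
have hg (x y : 'rV[R]_d) : enorm (x - y) <= eta ->
    (Ddiam phi eta x `^ q <= (EFin \o gs) y)%E.
  move=> xy; apply: (le_trans (Ddiam_pow_le x (ltW eta0))).
  rewrite /= /gs /K -mulrA EFinM lee_wpmul2l ?lee_fin ?powR_ge0//.
  apply: (@le_trans _ _ (Ddiam phi (2 * eta) y)).
    by apply: Ddiam_le_Ddiam; lra.
  rewrite (_ : eta^-1 = 2 / (2 * eta)); last by field; rewrite gt_eqF.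
  by apply: Ddiam_le_axis_diff2; rewrite // ?mulr_ge0 ?mulr_gt0// ltW.
have := @integral_le_ball_average R d rho r eta c _ _ eta0 c0 (fun y => closed_ball_mass_le y eta0)
  (fun x => poweR_ge0 (Ddiam phi eta x) q) _ mgs hg.
move=> /(_ (fun y => gs0 y))/le_trans; apply.
pose S := r + eta.
have S0 : 0 < S by rewrite addr_gt0.
pose C := L * D * (d%:R * L * S ^+ d.-1 * beta R d).
have intg : (\int[leb]_(y in closed_eball 0%R S) (EFin \o gs) y <=
    (K * (d%:R * C))%:E)%E.
  have mB := @measurable_closed_eball R d 0 S.
  under eq_integral do rewrite /= /gs EFinM.
  rewrite ge0_integralZl_EFin//; last 2 first.
  - by move=> y _; rewrite lee_fin.
  - exact/measurable_EFinP/measurable_funTS.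
  rewrite [leRHS]EFinM lee_wpmul2l ?lee_fin//.
  under eq_integral do rewrite -sumEFin.
  rewrite ge0_integral_sum//; last 2 first.
  - move=> i; apply/measurable_EFinP/measurable_funTS.
    exact: (measurable_axis_diff2 cphi phiD).
  - by move=> i y _; rewrite lee_fin axis_diff2_ge0.
  rewrite -[X in X%:R](card_ord d) mulr_natl -sumr_const -sumEFin.
  by apply: lee_sum => i _; apply: integral_axis_diff2_le => //; exact: ltW.
apply: (le_trans (lee_wpmul2l _ intg)).
  by rewrite lee_fin mulr_ge0// invr_ge0 mulr_ge0 ?beta_ge0// exprn_ge0// ltW.
rewrite -EFinM lee_fin (powR_predD _ d0 r0) -(mulr_powRB1 D0 q0).
have b0 := beta_gt0 (R := R) d.
(* The two factors [L], from the oscillation of the increments and from the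
   width of the layer, absorb the two factors [eta] in the denominator. *)
have L2 : L * L = 16 * d%:R * (eta * eta).
  by rewrite /L mulrACA -expr2 sqr_sqrtr ?ler0n//; ring.
have etad : eta ^+ d = eta * eta ^+ d.-1 by rewrite -exprS prednK.
have rtheta : r `^ theta * (eta / r) `^ theta = eta `^ theta.
  by rewrite -powRM ?divr_ge0 ?(ltW r0) ?(ltW eta0)// mulrC divfK// gt_eqF.
have -> : c_const R d * M * (r ^+ d.-1 * r `^ theta) * (D * D `^ (q - 1)) *
    (eta / r) `^ theta =
  (M * (D * D `^ (q - 1)) * eta `^ theta) * (c_const R d * r ^+ d.-1).
  by rewrite -rtheta; ring.
have etan0 : eta ^+ d.-1 != 0 by rewrite expf_neq0// gt_eqF.
have -> : (eta ^+ d * beta R d)^-1 * c * (K * (d%:R * C)) =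
  (M * (D * D `^ (q - 1)) * eta `^ theta) *
  (((6 / 5) ^+ d * d%:R ^+ 2 * S ^+ d.-1) * (L * L / (eta * eta))).
  by rewrite /c /K /C etad; field; rewrite etan0 !gt_eqF.
apply: ler_wpM2l; first by rewrite !mulr_ge0 ?powR_ge0// ltW.
rewrite L2 mulfK ?mulf_neq0 ?gt_eqF//.
have Sr : S ^+ d.-1 <= (6 / 5) ^+ d.-1 * r ^+ d.-1.
  rewrite -exprMn; apply: lerXn2r; rewrite ?nnegrE.
  - exact: ltW.
  - by rewrite mulr_ge0 ?(ltW r0)// divr_ge0.
  - by rewrite /S; lra.
have rn0 : 0 <= r ^+ d.-1 by rewrite exprn_ge0// ltW.
apply: le_trans (ler_wpM2r rn0 (c_const_ge d2)).
have h : 0 <= 16 * d%:R ^+ 3 * (6 / 5) ^+ d :> R.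
  by rewrite mulr_ge0 ?mulr_ge0 ?exprn_ge0// divr_ge0.
rewrite [leLHS](_ : _ = 16 * d%:R ^+ 3 * (6 / 5) ^+ d * S ^+ d.-1); last by ring.
by rewrite [leRHS](_ : _ = 16 * d%:R ^+ 3 * (6 / 5) ^+ d * ((6 / 5) ^+ d.-1 * r ^+ d.-1));
  [exact: ler_wpM2l|ring].
Qed.

Lemma mass_bound_ge1 : 1 <= M * ((6 / 5) ^+ d * (r ^+ d.-1 * r `^ theta)).
Proof. by rewrite -lee_fin -rho_supp; exact: closed_ball_mass_le. Qed.

(** For [eta > r / 5] the ratio [(eta / r) `^ theta] is at least [1 / 5], and the
  unit mass of [rho] forces [M * r `^ (d - 1 + theta)] to be bounded below. *)
Lemma integral_Ddiam_positive_radius eta : 0 < eta ->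
  (\int[rho]_(x in closed_eball 0%R r) (Ddiam phi eta x `^ q) <=
   (c_const R d * M * r `^ (d%:R - 1 + theta) * D `^ q * (eta / r) `^ theta)%:E)%E.
Proof.
move=> eta0; have [|etar] := leP eta (r / 5); first exact: integral_Ddiam_small_radius.
apply: (@le_trans _ _ (D `^ q)%:E).
  rewrite -[leRHS]mule1 -rho_supp -integral_cst; last exact: measurable_closed_eball.
  apply: le_integral_ge0 => x _ /=; first exact: poweR_ge0.
  by apply: Ddiam_pow_le_cst; exact: ltW.
rewrite lee_fin mulrAC ler_peMl ?powR_ge0//.
rewrite (powR_predD _ d0 r0).
have small : 1 / 5 <= (eta / r) `^ theta.
  apply: (@le_trans _ _ ((1 / 5) `^ theta)).
    by apply: ger1_powR => //; apply/andP; split; lra.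
  apply: ge0_ler_powR; rewrite ?nnegrE ?divr_ge0 ?(ltW eta0) ?(ltW r0) ?(ltW theta0)//.
  by rewrite ler_pdivlMr// mulrC mulrA mulr1 ltW.
have c5 : 5 * (6 / 5) ^+ d <= c_const R d.
  apply: le_trans (c_const_ge d2).
  rewrite [leRHS](_ : _ = 16 * d%:R ^+ 3 * (6 / 5) ^+ d.-1 * (6 / 5) ^+ d);
    last by ring.
  rewrite ler_wpM2r ?exprn_ge0 ?divr_ge0//.
  have h1 : 1 <= (6 / 5) ^+ d.-1 :> R by rewrite exprn_ege1//; lra.
  have h2 : 1 <= d%:R ^+ 3 :> R by rewrite exprn_ege1// ler1n.
  nra.
have W0 : 0 <= M * (r ^+ d.-1 * r `^ theta).
  by rewrite !mulr_ge0 ?powR_ge0 ?exprn_ge0 ?ltW.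
apply: (le_trans mass_bound_ge1).
rewrite (_ : M * _ = (5 * (6 / 5) ^+ d * (M * (r ^+ d.-1 * r `^ theta))) * (1 / 5));
  last by field.
apply: ler_pM => //.
- by rewrite mulr_ge0// mulr_ge0// exprn_ge0// divr_ge0.
- by rewrite -[leRHS]mulrA ler_wpM2r.
Qed.

(** The case [eta = 0] is the limit of the other ones, since [Ddiam] grows with
  the radius and [theta > 0]. *)
Lemma integral_Ddiam eta : 0 <= eta ->
  (\int[rho]_(x in closed_eball 0%R r) (Ddiam phi eta x `^ q) <=
   (c_const R d * M * r `^ (d%:R - 1 + theta) * D `^ q * (eta / r) `^ theta)%:E)%E.
Proof.
rewrite le_eqVlt => /orP[/eqP <-|]; last exact: integral_Ddiam_positive_radius.
rewrite mul0r powR0 ?gt_eqF// mulr0; apply/lee_addgt0Pr => e e0; rewrite add0e.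
set C := c_const R d * M * r `^ (d%:R - 1 + theta) * D `^ q.
have c0 : 0 <= c_const R d.
  by apply: le_trans (c_const_ge d2); rewrite !mulr_ge0 ?exprn_ge0 ?divr_ge0.
have C0 : 0 <= C by do 3?[apply: mulr_ge0]; rewrite ?powR_ge0 ?(ltW M0).
have C1 : 0 < C + 1 by rewrite ltr_wpDl.
(* The radius for which the bound equals [C * (e / (C + 1))]. *)
pose h := r * (e / (C + 1)) `^ theta^-1.
have h0 : 0 < h by rewrite mulr_gt0// powR_gt0// divr_gt0.
apply: (@le_trans _ _ (\int[rho]_(x in closed_eball 0%R r) (Ddiam phi h x `^ q))%E).
  apply: le_integral_ge0 => x _; first exact: poweR_ge0.
  by apply: Ddiam_pow_le_pow => //; exact: ltW.
apply: (le_trans (integral_Ddiam_positive_radius h0)); rewrite lee_fin -/C.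
rewrite /h [r * _]mulrC mulfK ?gt_eqF// -powRrM mulVf ?gt_eqF//.
rewrite powRr1; last by rewrite divr_ge0// ltW.
by rewrite mulrCA ler_piMr ?(ltW e0)// ler_pdivrMr// mul1r lerDl.
Qed.

End Main.

Unset Implicit Arguments.

Theorem theorem2p2 (R : realType) (d : nat) (hd : (2 <= d)%N)
  (phi : 'rV[R]_d -> R) (Y : set 'rV[R]_d)
  (phi_convex : convex_function setT phi)
  (Y_compact : compact Y) (Y_convex : convex_set Y)
  (phi_Y : subdiff_set phi setT `<=` Y)
  (r M theta : R) (r_gt0 : 0 < r) (M_gt0 : 0 < M)
  (theta_gt0 : 0 < theta) (theta_le1 : theta <= 1)
  (rho : probability (borel_rV R d) R)
  (rho_supp : rho (closed_eball 0 r) = 1%E)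
  (rho_ball : forall (x : 'rV[R]_d) (eta : R), 0 < eta ->
    (rho (eball x eta) <= (M * eta `^ (d%:R - 1 + theta))%:E)%E)
  (q : R) (q_ge1 : 1 <= q) (eta : R) (eta_ge0 : 0 <= eta) :
  (\int[rho]_(x in closed_eball 0 r) (Ddiam phi eta x `^ q)
     <= (c_const R d * M * r `^ (d%:R - 1 + theta))%:E
        * (ediam Y `^ q) * ((eta / r) `^ theta)%:E)%E.
Proof.
have [p hp] : subdiff phi 0 !=set0 by exact: exists_subgradient.
have Yp : Y p by apply: phi_Y; exists 0.
have YE : ediam Y = (fine (ediam Y))%:E.
  rewrite fineK// ge0_fin_numE ?compact_ediam_lty//.
  by apply: ediam_ge0; exists p.
have phiD u v : subdiff_set phi setT u -> subdiff_set phi setT v ->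
    enorm (u - v) <= fine (ediam Y).
  by move=> /phi_Y Yu /phi_Y Yv; rewrite -lee_fin -YE; exact: le_ediam.
rewrite YE poweR_EFin -!EFinM.
exact: (integral_Ddiam phi_convex phiD hd r_gt0 M_gt0 theta_gt0 theta_le1 q_ge1
  rho_supp rho_ball eta_ge0).
Qed.
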